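(* Let $\Lambda$ be a logic in $\mathbb L(\rightsquigarrow)$ that extends $\mathsf{HLC}^\sharp+\mathsf S_\Box$. Then $\Lambda$ is closed under the $\top$-Beth Rule: for every formula $\phi$, every propositional variable $p$ and every propositional variable $q$ not occurring in $\phi$, if $$\Lambda\vdash(\phi\wedge\phi[p:q])\to(p\leftrightarrow q),$$ then $$\Lambda\vdash\phi\to(p\leftrightarrow\phi[p:\top]).$$
   Context: Formulas of $\mathbb L(\rightsquigarrow)$ are built from propositional variables, $\top,\bot$, and binary connectives $\wedge,\vee,\to,\rightsquigarrow$. Abbreviations: $(\phi\leftrightarrow\psi):=((\phi\to\psi)\wedge(\psi\to\phi))$ and $\Box\phi:=(\top\rightsquigarrow\phi)$. $\phi[p:\psi]$ denotes the result of substituting $\psi$ for $p$ in $\phi$. A logic $\Lambda$ in $\mathbb L(\rightsquigarrow)$ is a set of formulas containing all substitution instances of the tautologies of intuitionistic propositional logic, closed under modus ponens and under substitution, and such that $\rightsquigarrow$ is extensional: if $\Lambda\vdash\phi_0\leftrightarrow\psi_0$ and $\Lambda\vdash\phi_1\leftrightarrow\psi_1$ then $\Lambda\vdash(\phi_0\rightsquigarrow\phi_1)\leftrightarrow(\psi_0\rightsquigarrow\psi_1)$. $\Lambda\vdash\phi$ means $\phi\in\Lambda$. The system $\mathsf{HLC}^\sharp$ is axiomatised by all axioms and rules of intuitionistic propositional logic, the rule: from $\vdash\phi\to\psi$ infer $\vdash\phi\rightsquigarrow\psi$, and the axiom schemes $((\phi\rightsquigarrow\psi)\wedge(\psi\rightsquigarrow\chi))\to(\phi\rightsquigarrow\chi)$,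 $((\phi\rightsquigarrow\psi)\wedge(\phi\rightsquigarrow\chi))\to(\phi\rightsquigarrow(\psi\wedge\chi))$, $((\phi\rightsquigarrow\chi)\wedge(\psi\rightsquigarrow\chi))\to((\phi\vee\psi)\rightsquigarrow\chi)$. $\mathsf{HLC}^\sharp+\mathsf S_\Box$ is the extension of $\mathsf{HLC}^\sharp$ with the axiom scheme $\mathsf S_\Box$: $\phi\to\Box\phi$.
   Formalization: The variable q is also required to be distinct from p; without this the rule fails for φ = ⊤ and q = p, where the premise is trivial but the conclusion would make p a theorem. *)

(* Defs.v *)
From Stdlib Require Import Arith.

Definition var := nat.

Inductive form : Type :=
  | Var (p : var)
  | Top
  | Bot
  | And (A B : form)
  | Or (A B : form)
  | Imp (A B : form)
  | Arrow (A B : form).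

Declare Scope form_scope.
Delimit Scope form_scope with form.
Bind Scope form_scope with form.
Local Open Scope form_scope.

Notation "⊤" := Top : form_scope.
Notation "⊥" := Bot : form_scope.
Notation "A ⇝ B" := (Arrow A B) (at level 64, no associativity) : form_scope.
Notation "A ∧ B" := (And A B) (at level 65, right associativity) : form_scope.
Notation "A ∨ B" := (Or A B) (at level 66, right associativity) : form_scope.
Notation "A ⇒ B" := (Imp A B) (at level 67, right associativity) : form_scope.
Notation "A ⇔ B" := (And (Imp A B) (Imp B A))
  (at level 68, no associativity) : form_scope.

Definition Box (A : form) : form := ⊤ ⇝ A.

Fixpoint occurs (q : var) (A : form) : Prop :=
  match A with
  | Var p => q = p
  | Top | Bot => False
  | And B C | Or B C | Imp B C | Arrow B C => occurs q B \/ occurs q C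
  end.

Fixpoint subst (s : var -> form) (A : form) : form :=
  match A with
  | Var p => s p
  | Top => Top
  | Bot => Bot
  | And B C => And (subst s B) (subst s C)
  | Or B C => Or (subst s B) (subst s C)
  | Imp B C => Imp (subst s B) (subst s C)
  | Arrow B C => Arrow (subst s B) (subst s C)
  end.

Definition subst1 (A : form) (p : var) (B : form) : form :=
  subst (fun r => if Nat.eqb r p then B else Var r) A.

Notation "A [ p := B ]" := (subst1 A p B) (at level 2, left associativity,
  p at level 200, B at level 200, format "A [ p  :=  B ]") : form_scope.

Inductive IPC_axiom : form -> Prop :=
  | ax_K A B : IPC_axiom (A ⇒ B ⇒ A)
  | ax_S A B C : IPC_axiom ((A ⇒ B ⇒ C) ⇒ (A ⇒ B) ⇒ A ⇒ C)
  | ax_and_l A B : IPC_axiom (A ∧ B ⇒ A)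
  | ax_and_r A B : IPC_axiom (A ∧ B ⇒ B)
  | ax_and_i A B : IPC_axiom (A ⇒ B ⇒ A ∧ B)
  | ax_or_l A B : IPC_axiom (A ⇒ A ∨ B)
  | ax_or_r A B : IPC_axiom (B ⇒ A ∨ B)
  | ax_or_e A B C : IPC_axiom ((A ⇒ C) ⇒ (B ⇒ C) ⇒ A ∨ B ⇒ C)
  | ax_top : IPC_axiom ⊤
  | ax_bot A : IPC_axiom (⊥ ⇒ A).

Fixpoint arrow_free (A : form) : Prop :=
  match A with
  | Var _ | Top | Bot => True
  | And B C | Or B C | Imp B C => arrow_free B /\ arrow_free C
  | Arrow _ _ => False
  end.

(* The tautologies of intuitionistic propositional logic proper: every formula
   in such a derivation is [arrow_free]. *)
Inductive IPC : form -> Prop :=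
  | IPC_ax A : arrow_free A -> IPC_axiom A -> IPC A
  | IPC_mp A B : IPC (A ⇒ B) -> IPC A -> IPC B.

Record is_logic (L : form -> Prop) : Prop := {
  logic_taut : forall A s, IPC A -> L (subst s A);
  logic_mp : forall A B, L (A ⇒ B) -> L A -> L B;
  logic_subst : forall A s, L A -> L (subst s A);
  logic_ext : forall A0 A1 B0 B1,
    L (A0 ⇔ B0) -> L (A1 ⇔ B1) -> L ((A0 ⇝ A1) ⇔ (B0 ⇝ B1))
}.

(* HLC♯ extended with the additional axioms [X]; HLC♯ itself is the case where
   [X] is empty. *)
Inductive HLCsharp_plus (X : form -> Prop) : form -> Prop :=
  | HLC_ipc A : IPC_axiom A -> HLCsharp_plus X A
  | HLC_mp A B :
      HLCsharp_plus X (A ⇒ B) -> HLCsharp_plus X A -> HLCsharp_plus X B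
  | HLC_nec A B : HLCsharp_plus X (A ⇒ B) -> HLCsharp_plus X (A ⇝ B)
  | HLC_trans A B C :
      HLCsharp_plus X (((A ⇝ B) ∧ (B ⇝ C)) ⇒ (A ⇝ C))
  | HLC_and A B C :
      HLCsharp_plus X (((A ⇝ B) ∧ (A ⇝ C)) ⇒ (A ⇝ (B ∧ C)))
  | HLC_or A B C :
      HLCsharp_plus X (((A ⇝ C) ∧ (B ⇝ C)) ⇒ ((A ∨ B) ⇝ C))
  | HLC_extra A : X A -> HLCsharp_plus X A.

Inductive S_Box : form -> Prop :=
  | S_Box_intro A : S_Box (A ⇒ Box A).

Definition extends (L M : form -> Prop) : Prop := forall A, M A -> L A.

(* [q <> p] is implied by [~ occurs q A] when p occurs in A. It matters only
   when p does not occur in A: with q = p the premise would then be trivial,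
   and A := ⊤ would make every variable a theorem. *)
Definition closed_under_top_Beth (L : form -> Prop) : Prop :=
  forall (A : form) (p q : var),
    ~ occurs q A -> q <> p ->
    L ((A ∧ A[p := Var q]) ⇒ (Var p ⇔ Var q)) ->
    L (A ⇒ (Var p ⇔ A[p := ⊤])).

(* Main.v *)
Require Import Defs.
From Stdlib Require Import Arith.

(** The two halves of the explicit definition [p ⇔ A[p := ⊤]] have different
    sources.

    - [A ∧ A[p := ⊤] ⇒ p] is the substitution instance [q := ⊤] of implicit
      definability [A ∧ A[p := q] ⇒ (p ⇔ q)].
    - [A ∧ p ⇒ A[p := ⊤]] holds because [p] entails [p ⇔ ⊤], and formulas
      that are equivalent under some hypotheses can be exchanged for one another
      under those hypotheses.  For the
      intuitionistic connectives this is always so; for [⇝] it is what [S_Box]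
      provides, since together with the other axioms it yields
      [(A ⇒ B) ⇒ (A ⇝ B)] as a theorem ([arrow_of_imp]), not merely as a rule.

    Reasoning under hypotheses is organised by the notion of a strict theory:
    a set of formulas containing the intuitionistic axioms, [(A ⇒ B) ⇒ (A ⇝ B)]
    and transitivity of [⇝], for which modus ponens is the only closure condition.
    Because no other rule is involved, adding a hypothesis to a strict theory gives a
    strict theory again ([strict_given]), so the replacement theorem
    [subst_congr] may be applied with the hypotheses [A] and [p] in force. *)

Local Open Scope form_scope.

Record ipc_theory (T : form -> Prop) : Prop := {
  theory_ax : forall A, IPC_axiom A -> T A;
  theory_mp : forall A B, T (A ⇒ B) -> T A -> T B
}.

Record strict_theory (T : form -> Prop) : Prop := {
  strict_ipc : ipc_theory T;
  strict_arrow : forall A B, T ((A ⇒ B) ⇒ (A ⇝ B));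
  strict_trans : forall A B C, T (((A ⇝ B) ∧ (B ⇝ C)) ⇒ (A ⇝ C))
}.

(** Writing [T (C ⇒ A)] as membership of [A] in a set turns implication
    introduction into a conversion and hypotheses into nested theories. *)
Definition given (T : form -> Prop) (C : form) : form -> Prop :=
  fun A => T (C ⇒ A).

Section Theory.

Variable T : form -> Prop.
Hypothesis HT : ipc_theory T.

Lemma given_weaken C A : T A -> given T C A.
Proof.
  intros H. apply (theory_mp T HT A); [|exact H].
  apply (theory_ax T HT), ax_K.
Qed.

Lemma given_hyp C : given T C C.
Proof.
  apply (theory_mp T HT (C ⇒ C ⇒ C)); [|apply (theory_ax T HT), ax_K].
  apply (theory_mp T HT (C ⇒ (C ⇒ C) ⇒ C)); [|apply (theory_ax T HT), ax_K].
  apply (theory_ax T HT), ax_S.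
Qed.

(** The deduction theorem, with axiom [ax_S] as its modus ponens case. *)
Lemma ipc_given C : ipc_theory (given T C).
Proof.
  split.
  - intros A HA. apply given_weaken, (theory_ax T HT), HA.
  - intros A B HAB HA. apply (theory_mp T HT (C ⇒ A)); [|exact HA].
    apply (theory_mp T HT (C ⇒ A ⇒ B)); [|exact HAB].
    apply (theory_ax T HT), ax_S.
Qed.

Lemma and_intro A B : T A -> T B -> T (A ∧ B).
Proof.
  intros HA HB. apply (theory_mp T HT B); [|exact HB].
  apply (theory_mp T HT A); [|exact HA].
  apply (theory_ax T HT), ax_and_i.
Qed.

Lemma and_left A B : T (A ∧ B) -> T A.
Proof. apply (theory_mp T HT), (theory_ax T HT), ax_and_l. Qed.

Lemma and_right A B : T (A ∧ B) -> T B.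
Proof. apply (theory_mp T HT), (theory_ax T HT), ax_and_r. Qed.

Lemma imp_trans A B C : T (A ⇒ B) -> T (B ⇒ C) -> T (A ⇒ C).
Proof.
  intros HAB HBC.
  apply (theory_mp _ (ipc_given A) B); [|exact HAB].
  now apply given_weaken.
Qed.

End Theory.

Lemma and_mono T A A' B B' : ipc_theory T ->
  T (A ⇒ A') -> T (B ⇒ B') -> T (A ∧ B ⇒ A' ∧ B').
Proof.
  intros HT HA HB. apply (and_intro _ (ipc_given T HT (A ∧ B))).
  - apply (imp_trans T HT _ A); [|exact HA]. apply (theory_ax T HT), ax_and_l.
  - apply (imp_trans T HT _ B); [|exact HB]. apply (theory_ax T HT), ax_and_r.
Qed.

Lemma or_mono T A A' B B' : ipc_theory T ->
  T (A ⇒ A') -> T (B ⇒ B') -> T (A ∨ B ⇒ A' ∨ B').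
Proof.
  intros HT HA HB.
  apply (theory_mp T HT (B ⇒ A' ∨ B')).
  - apply (theory_mp T HT (A ⇒ A' ∨ B')).
    + apply (theory_ax T HT), ax_or_e.
    + apply (imp_trans T HT _ A'); [exact HA|]. apply (theory_ax T HT), ax_or_l.
  - apply (imp_trans T HT _ B'); [exact HB|]. apply (theory_ax T HT), ax_or_r.
Qed.

Lemma imp_mono T A A' B B' : ipc_theory T ->
  T (A' ⇒ A) -> T (B ⇒ B') -> T ((A ⇒ B) ⇒ (A' ⇒ B')).
Proof.
  intros HT HA HB.
  apply (imp_trans _ (ipc_given T HT (A ⇒ B)) A' B);
    [|now apply given_weaken].
  apply (imp_trans _ (ipc_given T HT (A ⇒ B)) A' A);
    [now apply given_weaken | now apply given_hyp].
Qed.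

Lemma arrow_trans T A B C : strict_theory T ->
  T (A ⇝ B) -> T (B ⇝ C) -> T (A ⇝ C).
Proof.
  intros HT HAB HBC. pose proof (strict_ipc T HT) as HI.
  apply (theory_mp T HI ((A ⇝ B) ∧ (B ⇝ C))); [apply (strict_trans T HT)|].
  now apply and_intro.
Qed.

Lemma strict_given T C : strict_theory T -> strict_theory (given T C).
Proof.
  intros HT. pose proof (strict_ipc T HT) as HI. split.
  - now apply ipc_given.
  - intros A B. apply given_weaken, (strict_arrow T HT); exact HI.
  - intros A B D. apply given_weaken, (strict_trans T HT); exact HI.
Qed.

Lemma arrow_mono T A A' B B' : strict_theory T ->
  T (A' ⇒ A) -> T (B ⇒ B') -> T ((A ⇝ B) ⇒ (A' ⇝ B')).
Proof.
  intros HT HA HB. pose proof (strict_ipc T HT) as HI.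
  pose proof (strict_given T (A ⇝ B) HT) as HG.
  apply (arrow_trans _ A' B B' HG).
  - apply (arrow_trans _ A' A B HG); [|now apply given_hyp].
    apply (given_weaken T HI), (theory_mp T HI _ _ (strict_arrow T HT A' A) HA).
  - apply (given_weaken T HI), (theory_mp T HI _ _ (strict_arrow T HT B B') HB).
Qed.

(** Both implications are carried through one induction, since each feeds the
    other at the contravariant positions of [⇒] and [⇝]. *)
Lemma subst_congr T s t A : strict_theory T ->
  (forall r, T (s r ⇔ t r)) -> T (subst s A ⇔ subst t A).
Proof.
  intros HT Hst. pose proof (strict_ipc T HT) as HI.
  enough (H : T (subst s A ⇒ subst t A) /\ T (subst t A ⇒ subst s A))
    by now apply and_intro.
  induction A as [p| | |A [] B []|A [] B []|A [] B []|A [] B []]; simpl;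
    try (split; now apply given_hyp).
  - split; [eapply and_left | eapply and_right]; eauto.
  - split; now apply and_mono.
  - split; now apply or_mono.
  - split; now apply imp_mono.
  - split; now apply arrow_mono.
Qed.

Lemma subst_Var A : subst Var A = A.
Proof. induction A; simpl; congruence. Qed.

Lemma subst1_not_occurs A q B : ~ occurs q A -> A[q := B] = A.
Proof.
  unfold subst1. induction A; simpl; intros H; try reflexivity;
    try (f_equal; tauto).
  destruct (Nat.eqb_spec p q); congruence.
Qed.

Lemma subst1_rename A p q B :
  ~ occurs q A -> A[p := Var q][q := B] = A[p := B].
Proof.
  unfold subst1. induction A as [r| | | | | |]; simpl; intros H;
    try reflexivity; try (f_equal; tauto).
  destruct (Nat.eqb_spec r p); simpl.
  - now rewrite Nat.eqb_refl.
  - destruct (Nat.eqb_spec r q); congruence.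
Qed.

Lemma subst1_top T p A : strict_theory T ->
  T (Var p) -> T (A ⇔ A[p := ⊤]).
Proof.
  intros HT Hp. pose proof (strict_ipc T HT) as HI.
  unfold subst1. set (t := fun r => if Nat.eqb r p then ⊤ else Var r).
  enough (H : T (subst Var A ⇔ subst t A)) by now rewrite subst_Var in H.
  apply subst_congr; [exact HT|]. intros r. unfold t.
  destruct (Nat.eqb_spec r p) as [->|].
  - apply and_intro; [exact HI| |]; apply (given_weaken T HI).
    + apply (theory_ax T HI), ax_top.
    + exact Hp.
  - apply and_intro; [exact HI| |]; now apply given_hyp.
Qed.

Lemma HLC_ipc_theory X : ipc_theory (HLCsharp_plus X).
Proof. split; [apply HLC_ipc | apply HLC_mp]. Qed.

(** Under the hypothesis [A ⇒ B], [S_Box] gives [⊤ ⇝ (A ⇒ B)], hence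
    [A ⇝ (A ⇒ B)]; pairing this with [A ⇝ A] and detaching inside the
    arrow gives [A ⇝ B]. *)
Lemma arrow_of_imp A B : HLCsharp_plus S_Box ((A ⇒ B) ⇒ (A ⇝ B)).
Proof.
  set (M := HLCsharp_plus S_Box).
  assert (HM : ipc_theory M) by apply HLC_ipc_theory.
  pose proof (ipc_given M HM (A ⇒ B)) as HG.
  change (given M (A ⇒ B) (A ⇝ B)).
  assert (Hbox : given M (A ⇒ B) (⊤ ⇝ (A ⇒ B)))
    by (apply HLC_extra, S_Box_intro).
  assert (Hstep : given M (A ⇒ B) (A ⇝ (A ⇒ B))).
  { apply (theory_mp _ HG ((A ⇝ ⊤) ∧ (⊤ ⇝ (A ⇒ B)))).
    - apply (given_weaken M HM), HLC_trans.
    - apply (and_intro _ HG); [|exact Hbox].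
      apply (given_weaken M HM), HLC_nec, (given_weaken M HM), HLC_ipc, ax_top. }
  assert (Hpair : given M (A ⇒ B) (A ⇝ ((A ⇒ B) ∧ A))).
  { apply (theory_mp _ HG ((A ⇝ (A ⇒ B)) ∧ (A ⇝ A))).
    - apply (given_weaken M HM), HLC_and.
    - apply (and_intro _ HG); [exact Hstep|].
      apply (given_weaken M HM), HLC_nec, (given_hyp M HM). }
  apply (theory_mp _ HG ((A ⇝ ((A ⇒ B) ∧ A)) ∧ (((A ⇒ B) ∧ A) ⇝ B))).
  - apply (given_weaken M HM), HLC_trans.
  - apply (and_intro _ HG); [exact Hpair|].
    apply (given_weaken M HM), HLC_nec.
    apply (theory_mp _ (ipc_given M HM ((A ⇒ B) ∧ A)) A);
      apply HLC_ipc; constructor.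
Qed.

Lemma strict_logic L :
  is_logic L -> extends L (HLCsharp_plus S_Box) -> strict_theory L.
Proof.
  intros HL Hext. split.
  - split; [|exact (logic_mp L HL)].
    intros A HA. apply Hext, HLC_ipc, HA.
  - intros A B. apply Hext, arrow_of_imp.
  - intros A B C. apply Hext, HLC_trans.
Qed.

Theorem theorem3p3 (L : form -> Prop) :
  is_logic L ->
  extends L (HLCsharp_plus S_Box) ->
  closed_under_top_Beth L.
Proof.
  intros HL Hext A p q Hq Hqp Himpl.
  pose proof (strict_logic L HL Hext) as HS.
  pose proof (strict_ipc L HS) as HI.
  pose proof (strict_given L A HS) as HSA.
  pose proof (strict_ipc _ HSA) as HIA.
  apply (and_intro _ HIA).
  - pose proof (strict_given _ (Var p) HSA) as HSp.
    pose proof (strict_ipc _ HSp) as HIp.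
    apply (theory_mp _ HIp A).
    + apply (and_left _ HIp _ (A[p := ⊤] ⇒ A)).
      apply (subst1_top _ p A HSp), (given_hyp _ HIA).
    + apply (given_weaken _ HIA), (given_hyp _ HI).
  -
    (* The instance [q := ⊤] leaves [p] alone since [q <> p], and [A] since
       [q] is fresh for it. *)
    apply (logic_subst L HL _ (fun r => if Nat.eqb r q then ⊤ else Var r))
      in Himpl.
    change (L (A[q := ⊤] ∧ A[p := Var q][q := ⊤]
               ⇒ ((Var p)[q := ⊤] ⇔ (Var q)[q := ⊤]))) in Himpl.
    rewrite subst1_not_occurs, subst1_rename in Himpl by exact Hq.
    rewrite (subst1_not_occurs (Var p)) in Himpl by exact Hqp.
    unfold subst1 at 2 3 in Himpl; simpl in Himpl.
    rewrite Nat.eqb_refl in Himpl.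
    pose proof (ipc_given _ HIA (A[p := ⊤])) as HIt.
    apply (theory_mp _ HIt ⊤); [|apply (theory_ax _ HIt), ax_top].
    apply (and_right _ HIt (Var p ⇒ ⊤)).
    apply (theory_mp _ HIt (A ∧ A[p := ⊤])).
    + apply (given_weaken _ HIA), (given_weaken _ HI), Himpl.
    + apply (and_intro _ HIt).
      * apply (given_weaken _ HIA), (given_hyp _ HI).
      * apply (given_hyp _ HIA).
Qed.
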